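(* Let $c>0$ be the absolute constant used in the definition of the weights $d_k$ given in the context. There exist absolute constants $\kappa,C,c_1,c_2>0$ such that for all integers $n\ge2$, $p\ge2$, all $q\in(0,1)$ with $$nq^2(1-q)\ge\kappa\log p,$$ and all $x^*\in\mathbb{R}_+^p$, with probability larger than $1-C/p$, for all $k=1,\dots,p$, $$c_1\,\Psi_k\le d_k\le c_2\,\Psi_k,\qquad \Psi_k:=\sqrt{\log p\left[\frac{x^*_k}{nq}+\frac{\sum_{u\ne k}x^*_u}{n(1-q)}\right]}+\frac{\log(p)\,\|x^*\|_1}{n}+\frac{\log p}{nq(1-q)} .$$
   Context: Model: $A=(a_{\ell,k})\in\{0,1\}^{n\times p}$ has i.i.d. Bernoulli($q$) entries, and conditionally on $A$ the entries $Y_1,\dots,Y_n$ of $Y$ are independent with $Y_\ell\sim\mathrm{Poisson}((Ax^* )_\ell)$. The weights are $$d_k=\sqrt{6\log p}\left(\sqrt{\frac{3\log p}{2(n-1)^2q^2(1-q)^2}}+\sqrt{\frac{5\log p}{2(n-1)^2q^2(1-q)^2}+V_k^\top Y}\right)+\frac{\log p}{(n-1)q(1-q)}+c\left(\frac{3\log p}{n}+\frac{9\max(q^2,(1-q)^2)}{n^2q(1-q)}(\log p)^2\right)\hat N,$$ where $c>0$ is a fixed absolute constant ($c=126$ is a possible choice when $n\ge20$), $V_k\in\mathbb{R}^n$ has entries $$V_{k,\ell}=\left(\frac{na_{\ell,k}-\sum_{\ell'=1}^na_{\ell',k}}{n(n-1)q(1-q)}\right)^2,$$ and $$\hat N=\frac{1}{nq-\sqrt{6nq(1-q)\log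 p}-\max(q,1-q)\log p}\left(\sqrt{\frac{3\log p}{2}}+\sqrt{\frac{5\log p}{2}+\sum_{\ell=1}^nY_\ell}\right)^2 .$$ *)

(* Defs.v *)
From HB Require Import structures.
From mathcomp Require Import all_boot all_order all_algebra.
From mathcomp Require Import all_classical all_reals all_analysis.

Set Implicit Arguments.
Unset Strict Implicit.
Unset Printing Implicit Defensive.

Import Order.TTheory GRing.Theory Num.Theory.
Import numFieldNormedType.Exports.

Local Open Scope classical_set_scope.
Local Open Scope ring_scope.

Section probabilistic_model.
Context {d : measure_display} {T : measurableType d} {R : realType}.
Variable P : probability T R.

(* Elementary conditional probability P(F | E), meaningful when P(E) <> 0. *)
Definition cond_prob (E F : set T) : \bar R :=
  (fine (P (F `&` E)) / fine (P E))%:E.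

(* Mutual independence of the finite family (X i) under the set function mu,
   which below is either P or a conditional probability cond_prob E. *)
Definition mutually_independent (mu : set T -> \bar R) (d' : measure_display)
    (S : measurableType d') (I : finType) (X : I -> T -> S) : Prop :=
  forall (J : {set I}) (B : I -> set S), (forall i, measurable (B i)) ->
    mu [set w | forall i, i \in J -> B i (X i w)] =
    (\prod_(i in J) mu (X i @^-1` B i))%E.

Definition iid_bernoulli (n p : nat) (q : R)
    (A : 'I_n -> 'I_p -> {RV P >-> bool}) : Prop :=
  (forall l k (B : set bool), distribution P (A l k) B = bernoulli_prob q B) /\
  mutually_independent P (fun i : 'I_n * 'I_p => A i.1 i.2 : T -> bool).

Definition design (n p : nat) (A : 'I_n -> 'I_p -> {RV P >-> bool}) (w : T) :
    'M[R]_(n, p) :=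
  \matrix_(l, k) (A l k w)%:R.

Definition observations (n : nat) (Y : 'I_n -> {RV P >-> nat}) (w : T) :
    'cV[R]_n :=
  \col_l (Y l w)%:R.

(* Intensities may vanish: [poisson_prob 0 _] is the Dirac mass at 0.  The
   second argument of the library's [poisson_prob] is a dummy that does not
   affect its value. *)
Definition cond_poisson (n p : nat) (A : 'I_n -> 'I_p -> {RV P >-> bool})
    (Y : 'I_n -> {RV P >-> nat}) (x : 'cV[R]_p) : Prop :=
  forall a : 'M[R]_(n, p), P [set w | design A w = a] != 0%E ->
    let Pa := cond_prob [set w | design A w = a] in
    (forall l (B : set nat),
       Pa (Y l @^-1` B) = poisson_prob ((a *m x) l ord0) 0%N B) /\
    mutually_independent Pa (fun l => Y l : T -> nat).

End probabilistic_model.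

Section weights.
Context {R : realType} {n p : nat}.
Implicit Types (q c : R) (a : 'M[R]_(n, p)) (y : 'cV[R]_n) (x : 'cV[R]_p).

Let N : R := n%:R.
Let logp : R := ln p%:R.

Definition V_vec q a (k : 'I_p) : 'cV[R]_n :=
  \col_l ((N * a l k - \sum_(l' < n) a l' k)
          / (N * (N - 1) * q * (1 - q))) ^+ 2.

Definition N_hat q y : R :=
  (N * q - Num.sqrt (6 * N * q * (1 - q) * logp)
         - Num.max q (1 - q) * logp)^-1
  * (Num.sqrt (3 * logp / 2)
     + Num.sqrt (5 * logp / 2 + \sum_(l < n) y l ord0)) ^+ 2.

Definition weight c q a y (k : 'I_p) : R :=
  Num.sqrt (6 * logp)
  * (Num.sqrt (3 * logp / (2 * (N - 1) ^+ 2 * q ^+ 2 * (1 - q) ^+ 2))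
     + Num.sqrt (5 * logp / (2 * (N - 1) ^+ 2 * q ^+ 2 * (1 - q) ^+ 2)
                 + ((V_vec q a k)^T *m y) ord0 ord0))
  + logp / ((N - 1) * q * (1 - q))
  + c * (3 * logp / N
         + 9 * Num.max (q ^+ 2) ((1 - q) ^+ 2) / (N ^+ 2 * q * (1 - q))
           * logp ^+ 2)
    * N_hat q y.

Definition l1_norm x : R := \sum_(k < p) `|x k ord0|.

Definition Psi q x (k : 'I_p) : R :=
  Num.sqrt (logp * (x k ord0 / (N * q)
                    + (\sum_(u < p | u != k) x u ord0) / (N * (1 - q))))
  + logp * l1_norm x / N
  + logp / (N * q * (1 - q)).

End weights.
Arguments Psi {R} n {p}.

(* Main.v *)
Require Import Defs.
From HB Require Import structures.
From mathcomp Require Import all_boot all_order all_algebra.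
From mathcomp Require Import all_classical all_reals all_analysis.
From mathcomp Require Import ring lra.

Import Order.TTheory GRing.Theory Num.Theory.
Import numFieldNormedType.Exports.

Local Open Scope classical_set_scope.
Local Open Scope ring_scope.

(** Write [L] for [ln p], [N] for [n], and [m_k] for the conditional mean,
    given the design, of [V_k^T Y].  The proof is a concentration argument
    followed by a deterministic comparison.

    The design.  The mean [m_k] is linear in [x], and the coefficient of [x_u]
    is a sum over the rows of a function of the two entries in columns [k] and
    [u].  If [V_k] is computed with [q] in place of the empirical column mean,
    these coefficients have expectations of order [1 / (N q)] for [u = k] and
    [1 / (N (1 - q))] for [u <> k], which are the coefficients under the square
    root in [Psi].  The rarest of the row sums involved has mean
    [N q^2 (1 - q)], so the assumption that this exceeds [96 L] is what makes
    Chernoff bounds ([design_sum_concentration]) place all of them, for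
    all [p^2] pairs of columns at once, within a factor [4] of their means
    ([unbalanced_prob]).  The column sums and their complements are among
    these statistics, so that the empirical means may be exchanged with [q] and
    [1 - q] at the cost of constants ([sq_dev_compare]).

    The counts.  Given the design, [V_k^T Y] and the sum of the [Y_l] are
    combinations of independent Poisson variables whose weights lie, after
    rescaling, in [[0, 1]].  Bounding the Laplace transform of such a sum [S]
    of mean [m] gives [m / 2 - 2 L <= S <= 3 m + 2 L] except on an event of
    conditional probability at most [2 / p^2]
    ([observation_sum_concentration]), which survives a union bound over the
    [p + 1] sums and an average over the designs.

    The comparison.  On the intersection of these events the additive errors
    of order [L] are absorbed by the [L] that each square root in the weight
    already contains: the first term of the weight is of the order of
    [sqrt (L W)] up to [L / (N q (1 - q))], where [W] is the bracket in [Psi]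
    ([deviation_term_ge], [deviation_term_le]); the second term is of order
    [L / (N q (1 - q))]; and [N_hat] is of order [|x|_1] up to [L / (N q)], so
    that the third term is of order [L |x|_1 / N] up to [L / (N q (1 - q))]
    ([bias_term_ge], [bias_term_le]). *)

(** * Exponential bounds on the unit interval *)

Section exponential_chords.
Context {R : realType}.
Implicit Types g : R.

(** On the unit interval [1 - g / 2] lies above [1 / (1 + g)], which bounds
    [expR (- g)] because [1 + g <= expR g]. *)
Lemma expRN_le_chord g : 0 <= g <= 1 -> expR (- g) <= 1 - g / 2.
Proof.
move=> /andP[g0 g1]; rewrite expRN.
have e1 := expR_ge1Dx g.
have e0 : 0 < expR g by exact: expR_gt0.
rewrite -[leLHS]mul1r ler_pdivrMr//; nra.
Qed.

(** Writing [expR g] as [expR (- g / 2) ^- 2] reduces the bound to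
    [1 - g / 2 <= expR (- g / 2)]; any chord of slope at least [e - 1] would
    do, and the slope [3] avoids an estimate of [e]. *)
Lemma expR_le_chord g : 0 <= g <= 1 -> expR g <= 1 + 3 * g.
Proof.
move=> /andP[g0 g1].
have -> : expR g = (expR (- (g / 2)) ^+ 2)^-1.
  by rewrite expr2 -expRD -expRN; congr expR; lra.
have : 0 < expR (- (g / 2)) by exact: expR_gt0.
set e := expR _ => e0.
rewrite -[leLHS]mul1r ler_pdivrMr ?exprn_gt0//.
have e5 : 1 - g / 2 <= e.
  by have := expR_ge1Dx (- (g / 2)); rewrite -/e; lra.
have e6 : (1 - g / 2) ^+ 2 <= e ^+ 2 by rewrite ler_sqr// ?nnegrE; lra.
have : (1 + 3 * g) * (1 - g / 2) ^+ 2 <= (1 + 3 * g) * e ^+ 2.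
  by apply: ler_wpM2l => //; lra.
apply: le_trans.
have -> : (1 + 3 * g) * (1 - g / 2) ^+ 2
        = 1 + g * ((1 - g) * (2 - 3 / 4 * g)) by field.
by rewrite lerDl !mulr_ge0//; lra.
Qed.

End exponential_chords.

Lemma expRN_natM_ln {R : realType} (p m : nat) : (0 < p)%N ->
  expR (- (m%:R * ln (p%:R : R))) = p%:R ^- m.
Proof. by move=> p0; rewrite expRN expRM_natl lnK// posrE ltr0n. Qed.

(** * Union bounds and events with finitely or countably many values *)

Section finite_union_bound.
Context {d : measure_display} {T : measurableType d} {R : realType}.
Variable P : probability T R.

Lemma fine_prob_ge0 (E : set T) : 0 <= fine (P E).
Proof. exact: fine_ge0. Qed.

Lemma fine_prob_le_sum (I : finType) (D : {pred I}) (F : I -> set T)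
    (E : set T) :
  measurable E -> (forall i, measurable (F i)) ->
  (forall w, E w -> exists2 i, i \in D & F i w) ->
  fine (P E) <= \sum_(i in D) fine (P (F i)).
Proof.
move=> mE mF EF.
have PE F' : measurable F' -> P F' = (fine (P F'))%:E.
  by move=> mF'; rewrite fineK// fin_num_measure.
have : (P E <= \sum_(i \in [set` enum D]) P (F i))%E.
  apply: content_sub_fsum => //.
  by move=> w /EF[i Di Fi]; exists i; rewrite //= mem_enum.
rewrite -fsbig_seq ?enum_uniq// big_enum/= PE//.
under eq_bigr do rewrite PE//.
by rewrite sumEFin lee_fin.
Qed.

Lemma fine_prob_sum_le1 (I : finType) (F : I -> set T) :
  (forall i, measurable (F i)) -> trivIset setT F ->
  \sum_i fine (P (F i)) <= 1.
Proof.
move=> mF tF.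
rewrite -lee_fin -sumEFin.
under eq_bigr do rewrite fineK ?fin_num_measure//.
rewrite -big_enum/= fsbig_seq ?enum_uniq// -measure_fin_bigcup//.
- by apply: probability_le1; exact: fin_bigcup_measurable.

- exact: sub_trivIset tF.
Qed.

Lemma fine_probS (E F : set T) : measurable E -> measurable F ->
  E `<=` F -> fine (P E) <= fine (P F).
Proof.
move=> mE mF EF; rewrite fine_le ?fin_num_measure//.
by rewrite le_measure ?inE.
Qed.

Lemma fine_probU (E F : set T) : measurable E -> measurable F ->
  fine (P (E `|` F)) <= fine (P E) + fine (P F).
Proof.
move=> mE mF.
rewrite -lee_fin EFinD !fineK ?fin_num_measure//; last exact: measurableU.
exact: measureU2.
Qed.

End finite_union_bound.

Section discrete_events.
Context {d : measure_display} {T : measurableType d}.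

Lemma measurable_countable_preimage (K : countType) (Z : T -> K) (B : set K) :
  (forall z, measurable (Z @^-1` [set z])) -> measurable (Z @^-1` B).
Proof.
move=> mZ.
have -> : Z @^-1` B = \bigcup_(m in [set m | exists2 z, B z & pickle z = m])
    [set w | pickle (Z w) = m].
  apply/seteqP; split => [w Bw|w [m [z Bz <-]]] /=.
    by exists (pickle (Z w)) => //; exists (Z w).
  by move=> /(pcan_inj pickleK) ->.
apply: bigcup_measurable => m [z _ <-].
rewrite [X in measurable X](_ : _ = Z @^-1` [set z])//.
by apply/seteqP; split => w /= => [/(pcan_inj pickleK)|->].
Qed.

Lemma measurable_forall_fin (I : finType) (F : I -> set T) :
  (forall i, measurable (F i)) -> measurable [set w | forall i, F i w].
Proof.
move=> mF.
have -> : [set w | forall i, F i w] = \bigcap_(i in [set` enum I]) F i.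
  apply/seteqP; split => w /= h i; first by move=> _; exact: h.
  by apply: h; rewrite /= mem_enum.
by exact: fin_bigcap_measurable.
Qed.

(** Every event about a design and a count vector is determined by finitely
    many variables with countable range, so that measurability reduces to
    being a function of these values. *)
Lemma measurable_determined (I J : finType)
    (X : I -> {mfun T >-> bool}) (Y : J -> {mfun T >-> nat}) (E : set T) :
  (forall w w', (forall i, X i w = X i w') -> (forall j, Y j w = Y j w') ->
     E w -> E w') ->
  measurable E.
Proof.
move=> hE.
pose Z w : {ffun I -> bool} * {ffun J -> nat} :=
  ([ffun i => X i w], [ffun j => Y j w]).
have -> : E = Z @^-1` [set Z w | w in E].
  apply/seteqP; split => [w Ew|w [w' Ew'] ZZ] /=; first by exists w.
  move: ZZ => [/ffunP hX /ffunP hY].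
  by apply: hE Ew' => i; [have := hX i | have := hY i]; rewrite !ffunE.
apply: measurable_countable_preimage => -[a b].
rewrite [X in measurable X](_ : _ =
  [set w | forall i, X i w = a i] `&` [set w | forall j, Y j w = b j]);
  last first.
  apply/seteqP; split => w /=.
    by move=> [<- <-]; split => i; rewrite ffunE.
  by move=> [h h']; congr (_, _); apply/ffunP => i; rewrite ffunE.
apply: measurableI; apply: measurable_forall_fin => i.
  exact: (@measurable_funPTI _ _ _ _ (X i) [set a i]).
exact: (@measurable_funPTI _ _ _ _ (Y i) [set b i]).
Qed.

End discrete_events.

(** * The exponential Markov inequality *)

Section exponential_markov.
Context {d : measure_display} {T : measurableType d} {R : realType}.
Variable P : probability T R.

(** The exponential Markov inequality for a sum of functions of variables that
    are independent on the event [E]; the values considered are restricted to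
    the image of a finite type [K], which makes all expectations finite sums. *)
Lemma exponential_markov (n : nat) (K : finType) (S : Type) (iota : K -> S)
    (X : 'I_n -> T -> S) (pi : 'I_n -> K -> R) (E F : set T)
    (g : 'I_n -> S -> R) (b : 'I_n -> R) (s : R) :
  measurable F ->
  (forall z : {ffun 'I_n -> K},
     measurable (E `&` [set w | forall l, X l w = iota (z l)])) ->
  (forall l k, 0 <= pi l k) ->
  (forall z : {ffun 'I_n -> K},
     fine (P (E `&` [set w | forall l, X l w = iota (z l)]))
     = fine (P E) * \prod_l pi l (z l)) ->
  (forall l, \sum_k pi l k * expR (g l (iota k)) <= expR (b l)) ->
  (forall w, F w -> [/\ E w, exists z : {ffun 'I_n -> K},
       forall l, X l w = iota (z l) & \sum_l b l + s <= \sum_l g l (X l w)]) ->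
  fine (P F) <= fine (P E) * expR (- s).
Proof.
move=> mF mz pi0 hz hb hF.
pose D : pred {ffun 'I_n -> K} :=
  fun z => \sum_l b l + s <= \sum_l g l (iota (z l)).
apply: le_trans
  (_ : \sum_(z in D) fine (P (E `&` [set w | forall l, X l w = iota (z l)]))
       <= _).
  apply: fine_prob_le_sum => // w /hF[Ew [z hzw] hs].
  exists z; last by split.
  rewrite unfold_in /D; apply: le_trans hs _.
  by under eq_bigr do rewrite hzw.
under eq_bigr do rewrite hz.
rewrite -big_distrr/= ler_wpM2l// ?fine_prob_ge0//.
have e1 : \sum_(z : {ffun 'I_n -> K})
      \prod_l (pi l (z l) * expR (g l (iota (z l)))) <= expR (\sum_l b l).
  rewrite -(bigA_distr_bigA (fun l k => pi l k * expR (g l (iota k)))) expR_sum.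
  apply: ler_prod => l _; rewrite hb andbT.
  by apply: sumr_ge0 => k _; rewrite mulr_ge0// expR_ge0.
have -> : expR (- s) = expR (- (\sum_l b l + s)) * expR (\sum_l b l).
  by rewrite -expRD; congr expR; lra.
apply: le_trans (ler_wpM2l (expR_ge0 _) e1).
rewrite big_distrr/= [leRHS](bigID (mem D))/= -[leLHS]addr0 lerD//.
  (* On [D] the exponential of the excess is at least [1]. *)
  apply: ler_sum => z Dz.
  rewrite big_split/= mulrCA ler_peMr//; first exact: prodr_ge0.
  rewrite -expR_sum -expRD -[leLHS]expR0 ler_expR.
  by move: Dz; rewrite unfold_in /D; lra.
apply: sumr_ge0 => z _; rewrite mulr_ge0 ?expR_ge0//.
by apply: prodr_ge0 => l _; rewrite mulr_ge0 ?expR_ge0.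
Qed.

End exponential_markov.

(** * Chernoff bounds for two columns of the design *)

Section design_concentration.
Context {d : measure_display} {T : measurableType d} {R : realType}.
Variables (P : probability T R) (n p : nat) (q : R).
Variable A : 'I_n -> 'I_p -> {RV P >-> bool}.
Hypotheses (q01 : 0 < q < 1) (hA : iid_bernoulli q A).

Let w := bernoulli_pmf q.

Let w_ge0 b : 0 <= w b.
Proof. by apply: bernoulli_pmf_ge0; case/andP: q01 => *; rewrite !ltW. Qed.

Lemma bernoulli_prob_set1 (b : bool) : bernoulli_prob q [set b] = (w b)%:E.
Proof.
rewrite /bernoulli_prob fsbig_set1 ifT//.
by case/andP: q01 => *; rewrite !ltW.
Qed.

(** [void] indexes the empty family of counts: only the design matters. *)
Lemma measurable_design_pair (k u : 'I_p) (F : ('I_n -> bool * bool) -> Prop) :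
  measurable [set t | F (fun l => (A l k t, A l u t))].
Proof.
apply: (@measurable_determined _ _ _ void (fun i : 'I_n * 'I_p => A i.1 i.2)
  (of_void _)) => t t' htt' _ /=.
by congr (F _); apply/funext => l; rewrite (htt' (l, k)) (htt' (l, u)).
Qed.

Lemma design_pair_joint (k u : 'I_p) (z : {ffun 'I_n -> bool * bool}) :
  k != u ->
  fine (P (setT `&` [set t | forall l, (A l k t, A l u t) = z l]))
  = fine (P setT) * \prod_l (w (z l).1 * w (z l).2).
Proof.
move=> ku; rewrite setTI probability_setT/= mul1r.
case: hA => hd /(_ [set i | (i.2 == k) || (i.2 == u)]%SET
  (fun i => if i.2 == k then [set (z i.1).1] else [set (z i.1).2])).
have uu : (u == k) = false by rewrite eq_sym (negbTE ku).
set S := [set _ | _]; set S' := [set _ | _].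
have -> : S = S'.
  apply/seteqP; split => t; rewrite /S /S' /=.
    move=> h l; have := h (l, k); have := h (l, u).
    rewrite !inE/= uu !eqxx orbT/= => -> // -> //.
    by case: (z l).
  move=> h [l j]; rewrite inE/= => /orP[|] /eqP ->.
    by rewrite eqxx/= -(h l).
  by rewrite uu/= -(h l).
move=> -> //.
rewrite (_ : (\prod_(i in _) _)%E =
    (\prod_(i | (i.2 == k) || (i.2 == u))
       w (if i.2 == k then (z i.1).1 else (z i.1).2))%:E); last first.
  rewrite -prodEFin; apply: eq_big => [i|i _]; first by rewrite inE.
  by case: ifP => _; rewrite -bernoulli_prob_set1 -(hd i.1 i.2).
rewrite /= -(pair_big_dep xpredT (fun _ j => (j == k) || (j == u))
  (fun l j => w (if j == k then (z l).1 else (z l).2)))/=.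
apply: eq_bigr => l _.
rewrite (bigD1 k) ?eqxx//= (big_pred1 u) ?uu// => j.
by have [->|] := eqVneq j k; rewrite ?eqxx ?andbT//= (negbTE ku).
Qed.

(** The moment generating function of a [[0, 1]]-valued row statistic of mean
    [mu] is at most [expR (3 * mu)], and that of its opposite at most
    [expR (- mu / 2)].  Deviating to [4 * m] or [m / 4] thus costs at least
    [m / 4 >= 3 * ln p] in the exponent; the power [p ^- 3] leaves room for a
    union bound over the pairs of columns. *)
Lemma design_sum_concentration (k u : 'I_p) (g : bool -> bool -> R) (m : R) :
  k != u -> (forall b b', 0 <= g b b' <= 1) ->
  m = n%:R * \sum_b \sum_b' w b * w b' * g b b' ->
  12 * ln p%:R <= m ->
  fine (P [set t | ~~ (m / 4 <= \sum_l g (A l k t) (A l u t) <= 4 * m)])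
    <= 2 * p%:R ^- 3.
Proof.
move=> ku g01 mE mL.
have p0 : (0 < p)%N by apply: leq_ltn_trans (ltn_ord k).
have L0 : 0 <= ln (p%:R : R) by rewrite ln_ge0// ler1n.
pose mu := \sum_(c : bool * bool) w c.1 * w c.2 * g c.1 c.2.
have {}mE : m = n%:R * mu by rewrite mE /mu pair_big.
have mu0 : 0 <= mu.
  apply: sumr_ge0 => c _; rewrite !mulr_ge0 ?w_ge0//.
  by case/andP: (g01 c.1 c.2).
have w1 : \sum_(c : bool * bool) w c.1 * w c.2 = 1.
  rewrite -(pair_big xpredT xpredT (fun b b' => w b * w b'))/=.
  by rewrite !big_bool/= /w /bernoulli_pmf; ring.
pose S t := \sum_l g (A l k t) (A l u t).
have mS (Q : R -> Prop) : measurable [set t | Q (S t)].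
  by apply: (measurable_design_pair k u
    (fun c => Q (\sum_l g (c l).1 (c l).2))).
have tail (h : bool * bool -> R) (b s : R) :
    \sum_(c : bool * bool) w c.1 * w c.2 * expR (h c) <= expR b ->
    3 * ln p%:R <= s ->
    fine (P [set t | n%:R * b + s <= \sum_l h (A l k t, A l u t)])
      <= p%:R ^- 3.
  move=> hb hs.
  apply: le_trans
    (_ : fine (P setT) * expR (- s) <= _); last first.
    rewrite probability_setT/= mul1r.
    by rewrite -[leRHS]expRN_natM_ln// ler_expR lerN2.
  pose F (c : 'I_n -> bool * bool) := n%:R * b + s <= \sum_l h (c l).
  apply: (@exponential_markov _ _ _ P n _ _ id
    (fun l t => (A l k t, A l u t)) (fun _ c => w c.1 * w c.2) setT _
    (fun _ => h) (fun _ => b)) => //.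
  - exact: (measurable_design_pair k u F).
  - move=> z; rewrite setTI.
    exact: (measurable_design_pair k u (fun c => forall l, c l = z l)).
  - by move=> _ c; rewrite mulr_ge0.
  - by move=> z; rewrite design_pair_joint.
  - move=> t ht; split => //.
      by exists [ffun l => (A l k t, A l u t)] => l; rewrite ffunE.
    by rewrite sumr_const card_ord -mulr_natl.
have upper := tail (fun c => g c.1 c.2) (3 * mu) m.
have lower := tail (fun c => - g c.1 c.2) (- (mu / 2)) (m / 4).
rewrite [leRHS]mulr_natl mulr2n.
apply: (le_trans _ (lerD (upper _ _) (lower _ _))).
- have mT (h : bool * bool -> R) (a : R) :
      measurable [set t | a <= \sum_l h (A l k t, A l u t)].
    exact: (measurable_design_pair k u (fun c => a <= \sum_l h (c l))).
  have mU := mT (fun c => g c.1 c.2); have mL' := mT (fun c => - g c.1 c.2).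
  apply: (le_trans _ (fine_probU P _ _ (mU _) (mL' _))).
  apply: fine_probS; first exact: (mS (fun x => ~~ (m / 4 <= x <= 4 * m))).
    by apply: measurableU; [exact: mU|exact: mL'].
  move=> t /=; rewrite negb_and -!ltNge sumrN -/(S t) mE => /orP[hS|hS].
    by right; lra.
  by left; lra.
- apply: le_trans (expR_ge1Dx _).
  have -> : 1 + 3 * mu
      = \sum_(c : bool * bool) w c.1 * w c.2 * (1 + 3 * g c.1 c.2).
    rewrite /mu mulr_sumr -[X in X + _]w1 -big_split/=.
    by apply: eq_bigr => c _; ring.
  by apply: ler_sum => c _; rewrite ler_wpM2l ?mulr_ge0// expR_le_chord.
- lra.
- apply: le_trans (expR_ge1Dx _).
  have -> : 1 - mu / 2
      = \sum_(c : bool * bool) w c.1 * w c.2 * (1 - g c.1 c.2 / 2).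
    rewrite /mu mulr_suml -sumrN -[X in X + _]w1 -big_split/=.
    by apply: eq_bigr => c _; ring.
  by apply: ler_sum => c _; rewrite ler_wpM2l ?mulr_ge0// expRN_le_chord.
- lra.
Qed.

End design_concentration.

(** * Weighted sums of conditionally independent Poisson counts *)

Section poisson_laplace_transform.
Context {R : realType}.

(** With [0 ^+ 0 = 1], this formula also covers rate [0], where the law is the
    point mass at [0]. *)
Definition poisson_mass (r : R) (j : nat) : R := r ^+ j / j`!%:R * expR (- r).

Lemma poisson_mass_ge0 (r : R) (j : nat) : 0 <= r -> 0 <= poisson_mass r j.
Proof. by move=> r0; rewrite mulr_ge0 ?expR_ge0// divr_ge0// exprn_ge0. Qed.

Lemma poisson_prob_set1 (r : R) (j : nat) : 0 <= r ->
  poisson_prob r 0 [set j] = (poisson_mass r j)%:E.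
Proof.
rewrite /poisson_prob /poisson_mass; have [r0 _|r0 r0'] := ltP 0 r.
  by rewrite esum_set1 ?lee_fin ?poisson_pmf_ge0// /poisson_pmf r0.
have -> : r = 0 by apply/eqP; rewrite eq_le r0.
rewrite oppr0 expR0 mulr1 diracE expr0n.
case: j => [|j]; first by rewrite mem_set// divr1.
by rewrite memNset// mul0r.
Qed.

Lemma exp_partial_sum_le (r : R) (N : nat) : 0 <= r ->
  \sum_(j < N) r ^+ j / j`!%:R <= expR r.
Proof.
move=> r0; have cvg_r := @is_cvg_series_exp_coeff R r.
have nd : nondecreasing_seq (series (exp_coeff r)).
  by apply: nondecreasing_series => k _ _; rewrite divr_ge0 ?exprn_ge0.
by have := nondecreasing_cvgn_le nd cvg_r N; rewrite /series /= big_mkord.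
Qed.

(** Restricting the Laplace transform to the values below [N] keeps the sums
    finite; the bound does not depend on [N]. *)
Lemma poisson_mgf_le (r v : R) (N : nat) : 0 <= r ->
  \sum_(j < N) poisson_mass r j * expR (v * j%:R) <= expR (r * (expR v - 1)).
Proof.
move=> r0; rewrite mulrBr mulr1 expRD.
apply: le_trans (ler_wpM2r (expR_ge0 _) (exp_partial_sum_le _ N _)); last first.
  by rewrite mulr_ge0 ?expR_ge0.
rewrite mulr_suml; apply: ler_sum => j _.
rewrite /poisson_mass expRM_natr exprMn le_eqVlt.
by apply/orP; left; apply/eqP; ring.
Qed.

End poisson_laplace_transform.

Section observation_concentration.
Context {d : measure_display} {T : measurableType d} {R : realType}.
Variables (P : probability T R) (n p : nat) (x : 'cV[R]_p).
Variables (A : 'I_n -> 'I_p -> {RV P >-> bool}) (Y : 'I_n -> {RV P >-> nat}).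
Hypothesis hY : cond_poisson A Y x.

Lemma measurable_design_observations
    (F : 'M[R]_(n, p) -> ('I_n -> nat) -> Prop) :
  measurable [set t | F (design A t) (fun l => Y l t)].
Proof.
apply: (@measurable_determined _ _ _ _ (fun i : 'I_n * 'I_p => A i.1 i.2)
  Y) => t t' hA hY' /=.
have -> : design A t = design A t'.
  by apply/matrixP => l k; rewrite !mxE (hA (l, k)).
by congr (F _ _); apply/funext => l; rewrite hY'.
Qed.

Variable a : 'M[R]_(n, p).
Hypothesis ax0 : forall l, 0 <= (a *m x) l ord0.

Let E := [set t | design A t = a].

Let mE : measurable E.
Proof. exact: (measurable_design_observations (fun a' _ => a' = a)). Qed.

(** When the design value [a] has probability [0], the conditional law is
    meaningless but both sides vanish. *)
Lemma observation_joint (z : 'I_n -> nat) :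
  fine (P (E `&` [set t | forall l, Y l t = z l]))
  = fine (P E) * \prod_l poisson_mass ((a *m x) l ord0) (z l).
Proof.
set S := [set t | forall l, _].
have mS : measurable (E `&` S).
  exact: (measurable_design_observations
    (fun a' y => a' = a /\ forall l, y l = z l)).
have [PE0|PE0] := eqVneq (P E) 0%E.
  rewrite PE0 mul0r; apply/eqP; rewrite eq_le fine_prob_ge0 andbT.
  by have := @fine_probS _ _ _ P _ _ mS mE (@subIsetl _ _ _); rewrite PE0.
have [hd hi] := hY _ PE0.
have fE0 : fine (P E) != 0.
  by apply: contra_neq PE0 => h; rewrite -[LHS]fineK ?fin_num_measure// h.
have := hi [set: 'I_n]%SET (fun l => [set z l]) (fun _ => I).
rewrite (_ : [set t | forall l, l \in [set: 'I_n]%SET ->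
                       [set z l] (Y l t)] = S); last first.
  apply/seteqP; split => t /= h l; first by apply: h; rewrite inE.
  by move=> _; exact: h.
rewrite (_ : (\prod_(i in _) _)%E =
    (\prod_l poisson_mass ((a *m x) l ord0) (z l))%:E); last first.
  rewrite -prodEFin; apply: eq_big => [l|l _]; first by rewrite inE.
  by rewrite hd poisson_prob_set1.
by rewrite /cond_prob setIC => -[<-]; rewrite mulrC divfK.
Qed.

(** The finite-valued Markov inequality applies on the event that all counts
    are below [N]; as [N] grows, continuity of the measure along these
    increasing events removes the truncation. *)
Lemma observation_tail (h b : 'I_n -> R) (s : R) :
  (forall l, (a *m x) l ord0 * (expR (h l) - 1) <= b l) ->
  fine (P (E `&` [set t | \sum_l b l + s <= \sum_l h l * (Y l t)%:R]))
    <= fine (P E) * expR (- s).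
Proof.
move=> hb; set F := [set t | _].
pose G (N : nat) := (E `&` F) `&` [set t | forall l, (Y l t < N)%N].
have mG N : measurable (G N).
  exact: (measurable_design_observations (fun a' y =>
    (a' = a /\ \sum_l b l + s <= \sum_l h l * (y l)%:R)
    /\ forall l, (y l < N)%N)).
have mF : measurable (E `&` F).
  exact: (measurable_design_observations (fun a' y =>
    a' = a /\ \sum_l b l + s <= \sum_l h l * (y l)%:R)).
have GF : \bigcup_N G N = E `&` F.
  apply/seteqP; split => [t [N _ []]//|t EFt].
  exists (\max_l Y l t).+1 => //; split => // l.
  by rewrite ltnS leq_bigmax.
have hG N : (P (G N) <= (fine (P E) * expR (- s))%:E)%E.
  rewrite -[leLHS]fineK ?fin_num_measure// lee_fin.
  apply: (@exponential_markov _ _ _ P n 'I_N nat val (fun l t => Y l t)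
    (fun l j => poisson_mass ((a *m x) l ord0) j) E _
    (fun l j => h l * j%:R) b) => //.
  - move=> z; exact: (measurable_design_observations
      (fun a' y => a' = a /\ forall l, y l = z l)).
  - by move=> l j; exact: poisson_mass_ge0.
  - by move=> z; rewrite (observation_joint (fun l => z l)).
  - move=> l; apply: le_trans (poisson_mgf_le _ _ _ (ax0 l)) _.
    by rewrite ler_expR.
  - move=> t [[Et Ft] hN]; split => //.
    by exists [ffun l => Ordinal (hN l)] => l; rewrite ffunE.
have : (P \o G) N @[N --> \oo] --> P (\bigcup_N G N).
  apply: nondecreasing_cvg_mu => //; first by rewrite GF.
  move=> N N' NN'; apply/subsetPset => t [EFt hN]; split => // l.
  by apply: leq_trans (hN l) NN'.
rewrite GF => cG; rewrite -lee_fin fineK ?fin_num_measure//.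
rewrite -(cvg_lim _ cG)//; apply: lime_le.
  by apply/cvg_ex; exists (P (E `&` F)).
by apply: nearW => N; exact: hG.
Qed.

(** Since the Laplace transform of a Poisson variable of rate [r] is
    [expR (r * (expR v - 1))], the chord bounds on [expR] turn the mean [m]
    into [3 * m] or [m / 2], and an additional [2 * ln p] in the exponent makes
    each tail at most [p ^- 2]. *)
Lemma observation_sum_concentration (v : 'I_n -> R) (m : R) : (0 < p)%N ->
  (forall l, 0 <= v l <= 1) -> m = \sum_l v l * (a *m x) l ord0 ->
  fine (P (E `&` [set t | ~~ (m / 2 - 2 * ln p%:R
       <= \sum_l v l * (Y l t)%:R <= 3 * m + 2 * ln p%:R)]))
    <= fine (P E) * (2 * p%:R ^- 2).
Proof.
move=> p0 v01 mE'.
rewrite (_ : 2 * p%:R ^- 2 = p%:R ^- 2 + p%:R ^- 2); last first.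
  by rewrite mulr_natl mulr2n.
rewrite mulrDr -expRN_natM_ln//.
have mU (h b : 'I_n -> R) (s : R) :
    measurable (E `&` [set t | \sum_l b l + s <= \sum_l h l * (Y l t)%:R]).
  exact: (measurable_design_observations (fun a' y =>
    a' = a /\ \sum_l b l + s <= \sum_l h l * (y l)%:R)).
have upper := @observation_tail v (fun l => 3 * (v l * (a *m x) l ord0))
  (2 * ln p%:R).
have lower := @observation_tail (fun l => - v l)
  (fun l => - (v l * (a *m x) l ord0 / 2)) (2 * ln p%:R).
apply: (le_trans _ (lerD (upper _) (lower _))).
- have mV := mU v; have mL := mU (fun l => - v l).
  apply: (le_trans _ (fine_probU P _ _ (mV _ _) (mL _ _))).
  apply: fine_probS; last 1 first.
  + move=> t [Et /=]; rewrite negb_and -!ltNge => /orP[] ht; [right|left];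
      split => //=.
      under [leRHS]eq_bigr do rewrite mulNr.
      by rewrite !sumrN -mulr_suml -mE'; lra.
    by rewrite -mulr_sumr -mE'; lra.
  + exact: (measurable_design_observations (fun a' y =>
      a' = a /\ ~~ (m / 2 - 2 * ln p%:R
       <= \sum_l v l * (y l)%:R <= 3 * m + 2 * ln p%:R))).
  + by apply: measurableU; [exact: mV|exact: mL].
- by move=> l; have := ler_wpM2l (ax0 l) (expR_le_chord _ (v01 l)); lra.
- by move=> l; have := ler_wpM2l (ax0 l) (expRN_le_chord _ (v01 l)); lra.
Qed.

End observation_concentration.

(** * Size of the three terms of the weight *)

Section weight_terms.
Context {R : realType}.
Implicit Types N q L W G mu c s y m : R.

Lemma sqrt_le_of_sqr (a b : R) : 0 <= b -> a <= b ^+ 2 -> Num.sqrt a <= b.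
Proof. by move=> b0 ab; rewrite -(ger0_norm b0) -sqrtr_sqr ler_wsqrtr. Qed.

Definition signal_regime N q L :=
  [/\ 2 <= N, 0 < q, q < 1, 0 <= L & 96 * L <= N * q ^+ 2 * (1 - q)].

Lemma signal_regime_scales N q L : signal_regime N q L ->
  [/\ 96 * L <= N * q, 96 * L <= N * q * (1 - q),
      0 < N * q & 0 < N * q * (1 - q)].
Proof.
move=> [N2 q0 q1 L0 regime].
have Nq0 : 0 < N * q by apply: mulr_gt0; lra.
have Nqr0 : 0 < N * q * (1 - q) by apply: mulr_gt0; lra.
split => //.
  have qr1 : q * (1 - q) <= 1 by apply: mulr_ile1; lra.
  by have := ler_wpM2l (ltW Nq0) qr1; lra.
by have := ler_wpM2l (ltW Nqr0) (ltW q1); lra.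
Qed.

Lemma signal_regime_corrected_scale N q L : signal_regime N q L ->
  [/\ 0 < (N - 1) * q * (1 - q), (N - 1) * q * (1 - q) <= N * q * (1 - q)
    & N * q * (1 - q) <= 2 * ((N - 1) * q * (1 - q))].
Proof.
move=> [N2 q0 q1 L0 regime].
have qr0 : 0 < q * (1 - q) by apply: mulr_gt0; lra.
split.
- by rewrite -mulrA mulr_gt0//; lra.
- by rewrite -!mulrA ler_wpM2r ?ltW//; lra.
- have h : N <= 2 * (N - 1) by lra.
  by have := ler_wpM2r (ltW qr0) h; lra.
Qed.

(** Here [b] and [B] stand for [(N - 1) q (1 - q)] and [N q (1 - q)], [G] for
    [V_k^T Y] and [mu] for [b ^+ 2] times its conditional mean.  The fluctuation
    [- 2 * L] of [b ^+ 2 * G] is compensated by the [5 / 2 * L] that the weight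
    adds to it. *)
Lemma deviation_term_ge b B L W G mu : 0 < b -> b <= B -> B <= 2 * b ->
  0 <= L -> 0 <= W ->
  B ^+ 2 * W / 64 <= mu -> mu / 2 - 2 * L <= b ^+ 2 * G ->
  Num.sqrt (L * W) / 8 <=
  Num.sqrt (6 * L)
  * (Num.sqrt (3 * L / (2 * b ^+ 2))
     + Num.sqrt (5 * L / (2 * b ^+ 2) + G)).
Proof.
move=> b0 bB Bb L0.
have B0 : 0 < B by lra.
move=> W0 hmu hG.
have b20 : 0 < b ^+ 2 by rewrite exprn_gt0.
have hW : W / 128 <= 5 * L / (2 * b ^+ 2) + G.
  have -> : 5 * L / (2 * b ^+ 2) + G = (5 / 2 * L + b ^+ 2 * G) / b ^+ 2.
    by field; rewrite gt_eqF.
  rewrite ler_pdivlMr//.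
  have : b ^+ 2 * W <= B ^+ 2 * W.
    by rewrite ler_wpM2r// ler_sqr// ?nnegrE ltW.
  lra.
rewrite mulrDr -[leLHS]add0r lerD ?mulr_ge0 ?sqrtr_ge0//.
rewrite -sqrtrM ?mulr_ge0//.
have -> : (8 : R)^-1 = Num.sqrt (8^-1 ^+ 2) by rewrite sqrtr_sqr ger0_norm.
rewrite -sqrtrM ?mulr_ge0//; apply: ler_wsqrtr.
have := ler_wpM2l L0 hW; have : 0 <= L * W by rewrite mulr_ge0.
lra.
Qed.

(** In the upper bound the same additive terms of order [L] remain, and [L / B]
    is what they contribute outside the square root. *)
Lemma deviation_term_le b B L W G mu : 0 < b -> b <= B -> B <= 2 * b ->
  0 <= L -> 0 <= W ->
  mu <= 64 * (B ^+ 2 * W) -> b ^+ 2 * G <= 3 * mu + 2 * L ->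
  Num.sqrt (6 * L)
  * (Num.sqrt (3 * L / (2 * b ^+ 2))
     + Num.sqrt (5 * L / (2 * b ^+ 2) + G))
  <= 68 * Num.sqrt (L * W) + 17 * (L / B).
Proof.
move=> b0 bB Bb L0.
have B0 : 0 < B by lra.
move=> W0 hmu hG.
have b20 : 0 < b ^+ 2 by rewrite exprn_gt0.
have B2b : B ^+ 2 <= 4 * b ^+ 2.
  have -> : 4 * b ^+ 2 = (2 * b) ^+ 2 by ring.
  by rewrite ler_sqr// nnegrE; lra.
have ibB : (b ^+ 2)^-1 <= 4 * (B ^+ 2)^-1.
  by rewrite -[leLHS]mul1r ler_pdivrMr// mulrAC ler_pdivlMr ?exprn_gt0// mul1r.
set u := Num.sqrt (L * W).
have u2 : u ^+ 2 = L * W by rewrite sqr_sqrtr// mulr_ge0.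
have u0 : 0 <= u by exact: sqrtr_ge0.
have LB0 : 0 <= L / B by rewrite divr_ge0// ltW.
have LB2 : (L / B) ^+ 2 = L * (L / B ^+ 2) by field; rewrite gt_eqF.
have LbB : L / b ^+ 2 <= 4 * (L / B ^+ 2).
  by have := ler_wpM2l L0 ibB; lra.
have first_sqrt : Num.sqrt (6 * L) * Num.sqrt (3 * L / (2 * b ^+ 2))
    <= 6 * (L / B).
  rewrite -sqrtrM ?mulr_ge0//; apply: sqrt_le_of_sqr; first by rewrite mulr_ge0.
  rewrite exprMn LB2 invfM.
  by have := ler_wpM2l L0 LbB; lra.
have hG' : G <= (3 * mu + 2 * L) / b ^+ 2 by rewrite ler_pdivlMr// mulrC.
have hmu' : mu / b ^+ 2 <= 256 * W.
  rewrite ler_pdivrMr//; apply: le_trans hmu _.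
  by have := ler_wpM2r W0 B2b; lra.
have second_sqrt : Num.sqrt (6 * L) * Num.sqrt (5 * L / (2 * b ^+ 2) + G)
    <= 68 * u + 11 * (L / B).
  rewrite -sqrtrM ?mulr_ge0//; apply: sqrt_le_of_sqr.
    lra.
  have cross : 0 <= u * (L / B) by rewrite mulr_ge0.
  have := ler_wpM2l L0 LbB; have := ler_wpM2l L0 hG'.
  have := ler_wpM2l L0 hmu'; rewrite invfM.
  have -> : (68 * u + 11 * (L / B)) ^+ 2
      = 4624 * u ^+ 2 + 1496 * (u * (L / B)) + 121 * (L / B) ^+ 2 by ring.
  rewrite u2 LB2.
  have := mulr_ge0 L0 W0.
  have : 0 <= L * (L / B ^+ 2) by rewrite -LB2 exprn_ge0.
  lra.
lra.
Qed.

Lemma linear_term_bounds N q L : signal_regime N q L ->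
  L / (N * q * (1 - q)) <= L / ((N - 1) * q * (1 - q))
    <= 2 * (L / (N * q * (1 - q))).
Proof.
move=> hreg; have [N2 q0 q1 L0 regime] := hreg.
have [_ _ _ B0] := signal_regime_scales N q L hreg.
have [b0 bB Bb] := signal_regime_corrected_scale N q L hreg.
apply/andP; split.
  by rewrite ler_wpM2l// lef_pV2// posrE.
rewrite mulrCA ler_wpM2l// -[leLHS]mul1r ler_pdivrMr// mulrAC.
by rewrite ler_pdivlMr// mul1r.
Qed.

(** The subtracted terms of the denominator of the estimated total intensity
    cost at most half of [N * q], because [N * q] dominates [L]. *)
Lemma intensity_denominator_bounds N q L : signal_regime N q L ->
  N * q / 2 <= N * q - Num.sqrt (6 * N * q * (1 - q) * L)
               - Num.max q (1 - q) * L <= N * q.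
Proof.
move=> hreg; have [N2 q0 q1 L0 regime] := hreg.
have [Nq B_ge Nq0 B0] := signal_regime_scales N q L hreg.
have sq : Num.sqrt (6 * N * q * (1 - q) * L) <= N * q / 4.
  apply: sqrt_le_of_sqr; first by rewrite divr_ge0// ltW.
  (* The square of the bound is [(N q) ^+ 2 / 16 >= 6 * (N q) * L], because
     [N q >= 96 * L]. *)
  have h1 : N * q * (1 - q) <= N * q.
    by rewrite -[leRHS]mulr1 ler_wpM2l ?ltW//; lra.
  have := ler_wpM2r L0 h1; have := ler_wpM2l (ltW Nq0) Nq.
  lra.
have mx : Num.max q (1 - q) * L <= L.
  by rewrite -[leRHS]mul1r ler_wpM2r// ge_max; apply/andP; split; lra.
have mx0 : 0 <= Num.max q (1 - q) * L.
  by rewrite mulr_ge0// le_max (ltW q0).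
have sq0 := sqrtr_ge0 (6 * N * q * (1 - q) * L).
by apply/andP; split; lra.
Qed.

Definition intensity_estimate N q L y : R :=
  (N * q - Num.sqrt (6 * N * q * (1 - q) * L)
         - Num.max q (1 - q) * L)^-1
  * (Num.sqrt (3 * L / 2) + Num.sqrt (5 * L / 2 + y)) ^+ 2.

(** [s] stands for the l1 norm, [m] for the conditional mean of the total count
    and [y] for the total count. *)
Lemma intensity_estimate_ge N q L s m y : signal_regime N q L -> 0 <= s ->
  N * q * s / 4 <= m -> m / 2 - 2 * L <= y ->
  s / 8 <= intensity_estimate N q L y.
Proof.
move=> hreg; have [N2 q0 q1 L0 regime] := hreg.
have [Nq B_ge Nq0 B0] := signal_regime_scales N q L hreg.
move=> s0 hm hy.
rewrite /intensity_estimate; set D := (X in X^-1 * _).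
have /andP[D1 D2] : N * q / 2 <= D <= N * q.
  exact: intensity_denominator_bounds hreg.
have m0 : 0 <= m by apply: le_trans hm; rewrite divr_ge0// mulr_ge0// ltW.
have D0 : 0 < D by lra.
rewrite [leRHS]mulrC ler_pdivlMr//.
have hs : s * D <= s * (N * q) by rewrite ler_wpM2l.
have y0 : 0 <= 5 * L / 2 + y by lra.
apply: (@le_trans _ _ (Num.sqrt (5 * L / 2 + y) ^+ 2)).
  by rewrite sqr_sqrtr//; lra.
by rewrite ler_sqr ?nnegrE ?addr_ge0 ?sqrtr_ge0// lerDr sqrtr_ge0.
Qed.

Lemma intensity_estimate_le N q L s m y : signal_regime N q L -> 0 <= s ->
  m <= 4 * (N * q * s) -> 0 <= 5 * L / 2 + y -> y <= 3 * m + 2 * L ->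
  intensity_estimate N q L y <= 48 * s + 24 * (L / (N * q)).
Proof.
move=> hreg; have [N2 q0 q1 L0 regime] := hreg.
have [Nq B_ge Nq0 B0] := signal_regime_scales N q L hreg.
move=> s0 hm y0 hy.
rewrite /intensity_estimate; set D := (X in X^-1 * _).
have /andP[D1 D2] : N * q / 2 <= D <= N * q.
  exact: intensity_denominator_bounds hreg.
have D0 : 0 < D by lra.
rewrite mulrC ler_pdivrMr//.
apply: (@le_trans _ _ ((48 * s + 24 * (L / (N * q))) * (N * q / 2)));
  last first.
  by rewrite ler_wpM2l// addr_ge0// mulr_ge0// divr_ge0// ltW.
have -> : (48 * s + 24 * (L / (N * q))) * (N * q / 2)
    = 24 * (N * q * s) + 12 * L by field; rewrite !gt_eqF//; lra.
set e1 := Num.sqrt _; set e2 := Num.sqrt _.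
have h1 : e1 ^+ 2 = 3 * L / 2 by rewrite sqr_sqrtr//; lra.
have h2 : e2 ^+ 2 = 5 * L / 2 + y by rewrite sqr_sqrtr.
have := sqr_ge0 (e1 - e2); rewrite sqrrB sqrrD h1 h2; lra.
Qed.

(** The quadratic part of the coefficient is of the order of
    [(L / N) * (L / (N q (1 - q)))], and the second factor is at most [1]. *)
Lemma bias_coefficient_bounds N q L : signal_regime N q L ->
  3 * (L / N) <= 3 * L / N
    + 9 * Num.max (q ^+ 2) ((1 - q) ^+ 2) / (N ^+ 2 * q * (1 - q)) * L ^+ 2
    <= 12 * (L / N).
Proof.
move=> hreg; have [N2 q0 q1 L0 regime] := hreg.
have [Nq B_ge Nq0 B0] := signal_regime_scales N q L hreg.
set M := Num.max _ _.
have M0 : 0 <= M by rewrite le_max sqr_ge0.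
have M1 : M <= 1 by rewrite ge_max !expr_le1//; lra.
have -> : 9 * M / (N ^+ 2 * q * (1 - q)) * L ^+ 2
    = 9 * (L / N) * (M * (L / (N * q * (1 - q)))).
  by field; rewrite !gt_eqF//; lra.
have LN0 : 0 <= L / N by rewrite divr_ge0//; lra.
have LB1 : L / (N * q * (1 - q)) <= 1 by rewrite ler_pdivrMr// mul1r; lra.
have LB0 : 0 <= L / (N * q * (1 - q)) by rewrite divr_ge0// ltW.
have h1 : M * (L / (N * q * (1 - q))) <= 1 by rewrite mulr_ile1.
have h0 : 0 <= M * (L / (N * q * (1 - q))) by rewrite mulr_ge0.
have := ler_wpM2l LN0 h1; have := mulr_ge0 LN0 h0.
by move=> h2 h3; apply/andP; split; lra.
Qed.

Lemma bias_term_ge N q L c s m y : signal_regime N q L -> 0 < c -> 0 <= s ->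
  N * q * s / 4 <= m -> m / 2 - 2 * L <= y ->
  3 * c / 8 * (L * s / N) <=
  c * (3 * L / N
       + 9 * Num.max (q ^+ 2) ((1 - q) ^+ 2) / (N ^+ 2 * q * (1 - q)) * L ^+ 2)
    * intensity_estimate N q L y.
Proof.
move=> hreg; have [N2 q0 q1 L0 regime] := hreg.
have [Nq B_ge Nq0 B0] := signal_regime_scales N q L hreg.
move=> c0 s0 hm hy; have /andP[h1 _] := bias_coefficient_bounds N q L hreg.
have h2 := intensity_estimate_ge N q L s m y hreg s0 hm hy.
have LN0 : 0 <= L / N by rewrite divr_ge0//; lra.
have -> : 3 * c / 8 * (L * s / N) = c * (3 * (L / N)) * (s / 8).
  by field; rewrite gt_eqF//; lra.
apply: ler_pM => //.
- by rewrite mulr_ge0 ?(ltW c0)// mulr_ge0.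
- lra.
- by rewrite ler_wpM2l// ltW.
Qed.

(** The error [L / (N q)] in the estimated intensity is multiplied by
    [L / N <= 1], which makes it smaller than [L / (N q (1 - q))]. *)
Lemma bias_term_le N q L c s m y : signal_regime N q L -> 0 < c -> 0 <= s ->
  m <= 4 * (N * q * s) -> 0 <= 5 * L / 2 + y -> y <= 3 * m + 2 * L ->
  c * (3 * L / N
       + 9 * Num.max (q ^+ 2) ((1 - q) ^+ 2) / (N ^+ 2 * q * (1 - q)) * L ^+ 2)
    * intensity_estimate N q L y
  <= 576 * c * (L * s / N) + 288 * c * (L / (N * q * (1 - q))).
Proof.
move=> hreg; have [N2 q0 q1 L0 regime] := hreg.
have [Nq B_ge Nq0 B0] := signal_regime_scales N q L hreg.
move=> c0 s0 hm y0 hy; have /andP[h0 h1] := bias_coefficient_bounds N q L hreg.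
have h2 := intensity_estimate_le N q L s m y hreg s0 hm y0 hy.
have LN0 : 0 <= L / N by rewrite divr_ge0//; lra.
have LN1 : L / N <= 1.
  have : N * q <= N by rewrite -[leRHS]mulr1 ler_wpM2l//; lra.
  by rewrite ler_pdivrMr ?mul1r; lra.
have key : L / N * (L / (N * q)) <= L / (N * q * (1 - q)).
  have -> : L / (N * q * (1 - q)) = (1 - q)^-1 * (L / (N * q)).
    by field; rewrite !gt_eqF//; lra.
  rewrite ler_wpM2r//; first by rewrite divr_ge0// ltW.
  by apply: le_trans LN1 _; rewrite -[leLHS]invr1 lef_pV2 ?posrE; lra.
have est0 : 0 <= intensity_estimate N q L y.
  rewrite mulr_ge0 ?sqr_ge0// invr_ge0.
  by have /andP[+ _] := intensity_denominator_bounds N q L hreg; lra.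
apply: (@le_trans _ _ (c * (12 * (L / N)) * (48 * s + 24 * (L / (N * q))))).
  apply: ler_pM => //; last by rewrite ler_wpM2l// ltW.
  rewrite mulr_ge0 ?(ltW c0)//; apply: le_trans h0; lra.
have -> : c * (12 * (L / N)) * (48 * s + 24 * (L / (N * q)))
    = 576 * c * (L * s / N) + 288 * (c * ((L / N) * (L / (N * q)))).
  by field; rewrite !gt_eqF//; lra.
by have := ler_wpM2l (ltW c0) key; lra.
Qed.

End weight_terms.

(** * Weights on a balanced design *)

Section balanced_designs.
Context {R : realType} {n p : nat}.
Implicit Types (q : R) (a : 'M[R]_(n, p)) (x : 'cV[R]_p) (y : 'cV[R]_n).

Definition within_factor4 (m s : R) := m / 4 <= s <= 4 * m.

(** This is all that is retained of the randomness of the design.  The last sum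
    is, up to normalization, the coefficient of [x_u] in the conditional mean of
    [V_k^T Y], with [q] in place of the empirical column mean. *)
Definition balanced_design q a : Prop :=
  [/\ forall l k, exists b : bool, a l k = b%:R,
      forall k, within_factor4 (n%:R * q) (\sum_l a l k),
      forall k, within_factor4 (n%:R * (1 - q)) (\sum_l (1 - a l k))
    & forall k u, k != u -> within_factor4 (n%:R * q ^+ 2 * (1 - q))
        (\sum_l a l u * (a l k * (1 - q) ^+ 2 + (1 - a l k) * q ^+ 2))].

(** These are the entries of [V_k] rescaled to lie in the unit interval. *)
Definition sq_dev a (k : 'I_p) (l : 'I_n) : R :=
  ((n%:R * a l k - \sum_(l' < n) a l' k) / n%:R) ^+ 2.

Definition signal_rate q x (k : 'I_p) : R :=
  x k ord0 / (n%:R * q)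
  + (\sum_(u < p | u != k) x u ord0) / (n%:R * (1 - q)).

Lemma V_vec_sq_dev q a k l : (2 <= n)%N -> 0 < q < 1 ->
  ((n%:R - 1) * q * (1 - q)) ^+ 2 * V_vec q a k l ord0 = sq_dev a k l.
Proof.
move=> n2 /andP[q0 q1]; rewrite /V_vec mxE /sq_dev -exprMn.
have N2 : 2 <= n%:R :> R by rewrite ler_nat.
congr (_ ^+ 2); field; rewrite !gt_eqF//; lra.
Qed.

Lemma sum_bool_range a k : (forall l k', exists b : bool, a l k' = b%:R) ->
  0 <= \sum_(l < n) a l k <= n%:R.
Proof.
move=> ha; apply/andP; split.
  by apply: sumr_ge0 => l _; have [b ->] := ha l k.
have -> : n%:R = \sum_(l < n) (1 : R) by rewrite sumr_const card_ord.
by apply: ler_sum => l _; have [b ->] := ha l k; case: b.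
Qed.

Lemma sq_devE a k l : (0 < n)%N -> (exists b : bool, a l k = b%:R) ->
  sq_dev a k l = a l k * (1 - (\sum_(l' < n) a l' k) / n%:R) ^+ 2
    + (1 - a l k) * ((\sum_(l' < n) a l' k) / n%:R) ^+ 2.
Proof.
rewrite /sq_dev => n0 [b ->].
have N0 : n%:R != 0 :> R by rewrite pnatr_eq0 -lt0n.
by case: b => /=; field.
Qed.


Lemma sq_dev_le1 a k l : (0 < n)%N ->
  (forall l' k', exists b : bool, a l' k' = b%:R) -> 0 <= sq_dev a k l <= 1.
Proof.
move=> n0 ha; rewrite sqr_ge0/= sq_devE//.
have N0 : 0 < n%:R :> R by rewrite ltr0n.
have /andP[S0 S1] := sum_bool_range a k ha.
set s := _ / n%:R.
have s0 : 0 <= s by rewrite divr_ge0 // ltW.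
have s1 : s <= 1 by rewrite ler_pdivrMr// mul1r.
have h1 : s ^+ 2 <= 1 by rewrite expr_le1.
have h2 : (1 - s) ^+ 2 <= 1 by rewrite expr_le1//; lra.
by have [b ->] := ha l k; case: b; rewrite /=; lra.
Qed.

(** On a balanced design the empirical column mean is within a factor [4] of
    [q], and its complement within a factor [4] of [1 - q], so that replacing
    them by [q] and [1 - q] in the squared deviations costs a factor [16]. *)
Lemma sq_dev_compare q a k l : (0 < n)%N -> 0 < q < 1 -> balanced_design q a ->
  (a l k * (1 - q) ^+ 2 + (1 - a l k) * q ^+ 2) / 16 <= sq_dev a k l
    <= 16 * (a l k * (1 - q) ^+ 2 + (1 - a l k) * q ^+ 2).
Proof.
move=> n0 /andP[q0 q1] hb; have [ha hS hC _] := hb.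
have N0 : 0 < n%:R :> R by rewrite ltr0n.
have /andP[S1 S2] := hS k.
have /andP[] := hC k.
rewrite sumrB sumr_const card_ord => C1 C2.
rewrite sq_devE//; set s := _ / n%:R.
have sE : \sum_(l' < n) a l' k = s * n%:R by rewrite divfK// gt_eqF.
rewrite sE in S1 S2 C1 C2.
have s1 : q / 4 <= s by rewrite -(ler_pM2r N0); lra.
have s2 : s <= 4 * q by rewrite -(ler_pM2r N0); lra.
have t1 : (1 - q) / 4 <= 1 - s by rewrite -(ler_pM2r N0); lra.
have t2 : 1 - s <= 4 * (1 - q) by rewrite -(ler_pM2r N0); lra.
have sq (u v : R) : 0 <= u -> u <= v -> u ^+ 2 <= v ^+ 2.
  by move=> u0 uv; rewrite ler_sqr// nnegrE//; lra.
have := sq _ _ _ s1; have := sq _ _ _ s2; have := sq _ _ _ t1.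
have := sq _ _ _ t2.
have [b ->] := ha l k; case: b => /= h1 h2 h3 h4.
  rewrite !mul1r !subrr !mul0r !addr0.
  by apply/andP; split; [have := h2 ltac:(lra) | have := h1 ltac:(lra)]; lra.
rewrite !mul0r !subr0 !mul1r !add0r.
by apply/andP; split; [have := h4 ltac:(lra) | have := h3 ltac:(lra)]; lra.
Qed.

Lemma sum_mulmx (v : 'I_n -> R) a x :
  \sum_l v l * (a *m x) l ord0 = \sum_u x u ord0 * \sum_l v l * a l u.
Proof.
under eq_bigr do rewrite mxE mulr_sumr.
rewrite exchange_big/=; apply: eq_bigr => u _.
by rewrite mulr_sumr; apply: eq_bigr => l _; ring.
Qed.

Lemma sq_dev_column_self q a k : (0 < n)%N -> 0 < q < 1 ->
  balanced_design q a ->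
  n%:R * q * (1 - q) ^+ 2 / 64 <= \sum_l sq_dev a k l * a l k
    <= 64 * (n%:R * q * (1 - q) ^+ 2).
Proof.
move=> n0 /[dup] q01 /andP[q0 q1] /[dup] hb [ha hS _ _].
have r20 : 0 <= (1 - q) ^+ 2 by exact: sqr_ge0.
have /andP[S1 S2] := hS k.
have T1 : (1 - q) ^+ 2 / 16 * \sum_l a l k <= \sum_l sq_dev a k l * a l k.
  rewrite mulr_sumr; apply: ler_sum => l _.
  have /andP[+ _] := sq_dev_compare q a k l n0 q01 hb.
  by have [b ->] := ha l k; case: b => /=; lra.
have T2 : \sum_l sq_dev a k l * a l k <= 16 * (1 - q) ^+ 2 * \sum_l a l k.
  rewrite mulr_sumr; apply: ler_sum => l _.
  have /andP[_ +] := sq_dev_compare q a k l n0 q01 hb.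
  by have [b ->] := ha l k; case: b => /=; lra.
have := ler_wpM2l r20 S1; have := ler_wpM2l r20 S2.
by move=> h1 h2; apply/andP; split; lra.
Qed.

Lemma sq_dev_column_other q a k u : (0 < n)%N -> 0 < q < 1 ->
  balanced_design q a -> k != u ->
  n%:R * q ^+ 2 * (1 - q) / 64 <= \sum_l sq_dev a k l * a l u
    <= 64 * (n%:R * q ^+ 2 * (1 - q)).
Proof.
move=> n0 /[dup] q01 /andP[q0 q1] /[dup] hb [ha _ _ hZ] ku.
have /andP[] := hZ k u ku; set Z := \sum_l _ => Z1 Z2.
have T1 : Z / 16 <= \sum_l sq_dev a k l * a l u.
  rewrite /Z mulr_suml; apply: ler_sum => l _.
  have /andP[+ _] := sq_dev_compare q a k l n0 q01 hb.
  by have [b ->] := ha l u; case: b => /=; lra.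
have T2 : \sum_l sq_dev a k l * a l u <= 16 * Z.
  rewrite /Z mulr_sumr; apply: ler_sum => l _.
  have /andP[_ +] := sq_dev_compare q a k l n0 q01 hb.
  by have [b ->] := ha l u; case: b => /=; lra.
by apply/andP; split; lra.
Qed.

(** The mean of the weighted sum of the counts is, up to constants, the rate
    [signal_rate] that appears under the square root. *)
Lemma sq_dev_signal_bounds q a x k : (0 < n)%N -> 0 < q < 1 ->
  balanced_design q a -> (forall u, 0 <= x u ord0) ->
  (n%:R * q * (1 - q)) ^+ 2 * signal_rate q x k / 64
    <= \sum_l sq_dev a k l * (a *m x) l ord0
    <= 64 * ((n%:R * q * (1 - q)) ^+ 2 * signal_rate q x k).
Proof.
move=> n0 /[dup] q01 /andP[q0 q1] hb x0.
have N0 : 0 < n%:R :> R by rewrite ltr0n.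
rewrite sum_mulmx (bigD1 k)//=.
have -> : (n%:R * q * (1 - q)) ^+ 2 * signal_rate q x k
    = x k ord0 * (n%:R * q * (1 - q) ^+ 2)
      + \sum_(u < p | u != k) x u ord0 * (n%:R * q ^+ 2 * (1 - q)).
  rewrite -mulr_suml /signal_rate; field.
  by rewrite !gt_eqF//; lra.
have /andP[D1 D2] := sq_dev_column_self q a k n0 q01 hb.
have self1 := ler_wpM2l (x0 k) D1; have self2 := ler_wpM2l (x0 k) D2.
set m := n%:R * q ^+ 2 * (1 - q).
set others := \sum_(u < p | u != k) x u ord0 * \sum_l sq_dev a k l * a l u.
have rest1 : (\sum_(u < p | u != k) x u ord0 * m) / 64 <= others.
  rewrite mulr_suml; apply: ler_sum => u uk; rewrite eq_sym in uk.
  have /andP[rest1 _] := sq_dev_column_other q a k u n0 q01 hb uk.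
  by have := ler_wpM2l (x0 u) rest1; rewrite /m; lra.
have rest2 : others <= 64 * \sum_(u < p | u != k) x u ord0 * m.
  rewrite mulr_sumr; apply: ler_sum => u uk; rewrite eq_sym in uk.
  have /andP[_ rest2] := sq_dev_column_other q a k u n0 q01 hb uk.
  by have := ler_wpM2l (x0 u) rest2; rewrite /m; lra.
by apply/andP; split; lra.
Qed.

Lemma total_intensity_bounds q a x : balanced_design q a ->
  (forall u, 0 <= x u ord0) ->
  n%:R * q * l1_norm x / 4 <= \sum_l 1 * (a *m x) l ord0
    <= 4 * (n%:R * q * l1_norm x).
Proof.
move=> [_ hS _ _] x0; rewrite (sum_mulmx (fun _ => 1)) /l1_norm.
have h u : \sum_l 1 * a l u = \sum_l a l u.
  by apply: eq_bigr => l _; rewrite mul1r.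
rewrite !mulr_sumr mulr_suml; apply/andP; split; apply: ler_sum => u _;
  have /andP[S1 S2] := hS u; rewrite h ger0_norm//.
- by have := ler_wpM2l (x0 u) S1; lra.
- by have := ler_wpM2l (x0 u) S2; lra.
Qed.

Definition concentrated (L : R) (v : 'I_n -> R) a x y : bool :=
  let m := \sum_l v l * (a *m x) l ord0 in
  m / 2 - 2 * L <= \sum_l v l * y l ord0 <= 3 * m + 2 * L.

(** In the lower bound each term of [Psi] is matched with one term of the
    weight; in the upper bound all error terms are of the order of the last
    term of [Psi], which the coefficient [68 + 576 * c] dominates. *)
Lemma weight_equivalent (c q : R) a x y (k : 'I_p) : 0 < c ->
  (2 <= n)%N -> (0 < p)%N -> 0 < q < 1 ->
  96 * ln p%:R <= n%:R * q ^+ 2 * (1 - q) ->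
  (forall u, 0 <= x u ord0) -> (forall l, 0 <= y l ord0) ->
  balanced_design q a ->
  concentrated (ln p%:R) (sq_dev a k) a x y ->
  concentrated (ln p%:R) (fun=> 1) a x y ->
  Num.min (1 / 8) (3 * c / 8) * Psi n q x k <= weight c q a y k
    <= (68 + 576 * c) * Psi n q x k.
Proof.
move=> c0 n2 p0 /[dup] q01 /andP[q0 q1] hreg x0 y0 hb.
move=> /andP[G1 G2] /andP[T1 T2].
have n0 : (0 < n)%N by exact: leq_trans n2.
have N2 : 2 <= n%:R :> R by rewrite ler_nat.
set L := ln p%:R in hreg G1 G2 T1 T2 *.
have L0 : 0 <= L by rewrite ln_ge0// ler1n.
have reg : signal_regime n%:R q L by split.
have [_ _ Nq0 B0] := signal_regime_scales _ _ _ reg.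
have [b0 bB Bb] := signal_regime_corrected_scale _ _ _ reg.
set b := (n%:R - 1) * q * (1 - q) in b0 bB Bb.
have W0 : 0 <= signal_rate q x k.
  by rewrite /signal_rate addr_ge0// divr_ge0 ?sumr_ge0// mulr_ge0//; lra.
set W := signal_rate q x k in W0.
set s := l1_norm x.
have s0 : 0 <= s by apply: sumr_ge0.
have VY : b ^+ 2 * ((V_vec q a k)^T *m y) ord0 ord0
    = \sum_l sq_dev a k l * y l ord0.
  rewrite mxE mulr_sumr; apply: eq_bigr => l _.
  by rewrite mulrA mxE V_vec_sq_dev.
have Y1 : \sum_l 1 * y l ord0 = \sum_(l < n) y l ord0.
  by apply: eq_bigr => l _; rewrite mul1r.
rewrite Y1 in T1 T2; rewrite -VY in G1 G2.
have Y0 : 0 <= \sum_(l < n) y l ord0 by apply: sumr_ge0.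
have /andP[M1 M2] := total_intensity_bounds q a x hb x0.
have /andP[m1 m2] := sq_dev_signal_bounds q a x k n0 q01 hb x0.
rewrite -/s in M1 M2; rewrite -/W in m1 m2.
have lo1 := deviation_term_ge _ _ _ _ _ _ b0 bB Bb L0 W0 m1 G1.
have hi1 := deviation_term_le _ _ _ _ _ _ b0 bB Bb L0 W0 m2 G2.
have /andP[lo2 hi2] := linear_term_bounds _ _ _ reg.
have lo3 := bias_term_ge _ _ _ c _ _ _ reg c0 s0 M1 T1.
have Y0' : 0 <= 5 * L / 2 + \sum_(l < n) y l ord0 by lra.
have hi3 := bias_term_le _ _ _ c _ _ _ reg c0 s0 M2 Y0' T2.
have -> : Psi n q x k = Num.sqrt (L * W) + L * s / n%:R
    + L / (n%:R * q * (1 - q)) by [].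
have -> : weight c q a y k =
    Num.sqrt (6 * L) * (Num.sqrt (3 * L / (2 * b ^+ 2))
      + Num.sqrt (5 * L / (2 * b ^+ 2) + ((V_vec q a k)^T *m y) ord0 ord0))
    + L / ((n%:R - 1) * q * (1 - q))
    + c * (3 * L / n%:R + 9 * Num.max (q ^+ 2) ((1 - q) ^+ 2)
           / (n%:R ^+ 2 * q * (1 - q)) * L ^+ 2)
      * intensity_estimate n%:R q L (\sum_(l < n) y l ord0).
  have -> : 2 * b ^+ 2
      = 2 * (n%:R - 1) ^+ 2 * q ^+ 2 * (1 - q) ^+ 2 by rewrite /b; ring.
  by [].
have u0 := sqrtr_ge0 (L * W).
have v0 : 0 <= L * s / n%:R by rewrite divr_ge0// mulr_ge0.
have w0 : 0 <= L / (n%:R * q * (1 - q)) by rewrite divr_ge0// ltW.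
set u := Num.sqrt (L * W) in u0 lo1 hi1 *.
set v := L * s / n%:R in v0 lo3 hi3 *.
set w := L / (n%:R * q * (1 - q)) in w0 lo2 hi1 hi2 hi3 *.
set e := Num.min _ _.
have e1 : e <= 1 / 8 by rewrite ge_min lexx.
have e2 : e <= 3 * c / 8 by rewrite ge_min lexx orbT.
have := ler_wpM2r u0 e1; have := ler_wpM2r v0 e2; have := ler_wpM2r w0 e1.
have := mulr_ge0 (ltW c0) u0; have := mulr_ge0 (ltW c0) w0.
by move=> *; apply/andP; split; lra.
Qed.

End balanced_designs.

(** * Probability of the favourable event *)

Section good_events.
Context {d : measure_display} {T : measurableType d} {R : realType}.
Variables (P : probability T R) (n p : nat) (q : R) (x : 'cV[R]_p).
Variables (A : 'I_n -> 'I_p -> {RV P >-> bool}) (Y : 'I_n -> {RV P >-> nat}).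
Hypotheses (n2 : (2 <= n)%N) (p2 : (2 <= p)%N) (q01 : 0 < q < 1).
Hypothesis signal : 96 * ln p%:R <= n%:R * q ^+ 2 * (1 - q).
Hypothesis x0 : forall u, 0 <= x u ord0.
Hypotheses (hA : iid_bernoulli q A) (hY : cond_poisson A Y x).

(** The three quantities that a balanced design controls are sums over the rows
    of functions of a pair of entries, so that one concentration bound serves for
    all of them. *)
Definition pair_stat (i : option bool) (b b' : bool) : R :=
  match i with
  | Some true => b%:R
  | Some false => 1 - b%:R
  | None => b'%:R * (b%:R * (1 - q) ^+ 2 + (1 - b%:R) * q ^+ 2)
  end.

Definition pair_mean (i : option bool) : R :=
  match i with
  | Some true => n%:R * q
  | Some false => n%:R * (1 - q)
  | None => n%:R * q ^+ 2 * (1 - q)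
  end.

Lemma pair_stat_range i b b' : 0 <= pair_stat i b b' <= 1.
Proof.
have /andP[q0 q1] := q01.
have h1 : q ^+ 2 <= 1 by rewrite expr_le1//; lra.
have h2 : (1 - q) ^+ 2 <= 1 by rewrite expr_le1//; lra.
have h3 := sqr_ge0 q; have h4 := sqr_ge0 (1 - q).
by case: i => [[]|]; case: b; case: b' => /=; apply/andP; split; lra.
Qed.

Lemma pair_stat_mean i : pair_mean i =
  n%:R * \sum_b \sum_b'
    bernoulli_pmf q b * bernoulli_pmf q b' * pair_stat i b b'.
Proof.
by case: i => [[]|]; rewrite !big_bool/= /bernoulli_pmf/=; ring.
Qed.

Lemma pair_mean_ge i : 96 * ln p%:R <= pair_mean i.
Proof.
apply: le_trans signal _; have /andP[q0 q1] := q01.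
have N0 : 0 <= n%:R :> R by [].
have q2 : q ^+ 2 <= 1 by rewrite expr_le1//; lra.
have qq : q ^+ 2 * (1 - q) <= q.
  by rewrite expr2 -mulrA ger_pMr// mulr_ile1; lra.
have qr : q ^+ 2 * (1 - q) <= 1 - q by rewrite ler_piMl//; lra.
by case: i => [[]|] //=; rewrite -mulrA ler_wpM2l.
Qed.

(** There are at most [3 * p ^ 2] statistics, each failing with probability at
    most [2 * p ^- 3]. *)
Lemma unbalanced_prob :
  fine (P [set t | ~ balanced_design q (design A t)]) <= 6 / p%:R.
Proof.
have p0 : 0 < p%:R :> R by rewrite ltr0n (leq_trans _ p2).
have L0 : 0 <= ln (p%:R : R) by rewrite ln_ge0// ler1n (leq_trans _ p2).
pose F (c : 'I_p * 'I_p * option bool) := [set t | ~~ (pair_mean c.2 / 4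
  <= \sum_l pair_stat c.2 (A l c.1.1 t) (A l c.1.2 t) <= 4 * pair_mean c.2)].
pose D : {pred 'I_p * 'I_p * option bool} := fun c => c.1.1 != c.1.2.
apply: (@le_trans _ _ (\sum_(c in D) fine (P (F c)))).
  apply: fine_prob_le_sum.
  - exact: (measurable_design_observations P n p A Y
      (fun a _ => ~ balanced_design q a)).
  - move=> c; exact: (measurable_design_pair P n p A c.1.1 c.1.2 (fun z =>
      ~~ (pair_mean c.2 / 4 <= \sum_l pair_stat c.2 (z l).1 (z l).2
          <= 4 * pair_mean c.2))).
  move=> t; apply: contra_notP => hF.
  have hk i (k u : 'I_p) : k != u -> within_factor4 (pair_mean i)
      (\sum_l pair_stat i (A l k t) (A l u t)).
    by move=> ku; apply: contra_notT hF => hku; exists (k, u, i).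
  (* A statement on a single column is read off any pair that contains it,
     which is possible because [p] is at least [2]. *)
  have other (k : 'I_p) : exists u : 'I_p, k != u.
    have p1 : (0 < p)%N by exact: leq_trans p2.
    have [k0|k0] := eqVneq (val k) 0%N.
      by exists (Ordinal p2); rewrite -val_eqE /= k0.
    by exists (Ordinal p1); rewrite -val_eqE.
  split.
  - by move=> l k; exists (A l k t); rewrite mxE.
  - move=> k; have [u ku] := other k; have := hk (Some true) k u ku.
    by congr within_factor4; apply: eq_bigr => l _; rewrite mxE.
  - move=> k; have [u ku] := other k; have := hk (Some false) k u ku.
    by congr within_factor4; apply: eq_bigr => l _; rewrite mxE.
  - move=> k u ku; have := hk None k u ku.
    by congr within_factor4; apply: eq_bigr => l _; rewrite !mxE.
have hc c : c \in D -> fine (P (F c)) <= 2 * p%:R ^- 3.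
  move=> Dc; apply: (design_sum_concentration P n p q A q01 hA c.1.1 c.1.2
    (pair_stat c.2) (pair_mean c.2)) => //.
  - exact: pair_stat_range.
  - exact: pair_stat_mean.
  - by apply: le_trans (pair_mean_ge _); rewrite ler_wpM2r// ler_nat.
apply: le_trans (ler_sum _ hc) _.
apply: (@le_trans _ _ (\sum_(c : 'I_p * 'I_p * option bool) 2 * p%:R ^- 3)).
  by rewrite [leRHS](bigID (mem D))/= lerDl sumr_ge0// => c _;
    rewrite mulr_ge0// invr_ge0 exprn_ge0 ?ltW.
rewrite sumr_const !card_prod card_option card_bool !card_ord.
rewrite -[leLHS]mulr_natr !natrM.
rewrite le_eqVlt; apply/orP; left; apply/eqP.
by field; rewrite gt_eqF.
Qed.

Lemma design_signal_ge0 (a : 'M[R]_(n, p)) l :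
  (forall l k, exists b : bool, a l k = b%:R) -> 0 <= (a *m x) l ord0.
Proof.
move=> ha; rewrite mxE; apply: sumr_ge0 => k _.
by have [b ->] := ha l k; rewrite mulr_ge0.
Qed.

(** [None] stands for the total count, [Some k] for the rescaled [V_k^T Y]. *)
Definition all_concentrated (a : 'M[R]_(n, p)) (y : 'cV[R]_n) : Prop :=
  forall i : option 'I_p,
    concentrated (ln p%:R) (if i is Some k then sq_dev a k else fun=> 1) a x y.

(** The [p + 1] sums fail with conditional probability at most [2 * p ^- 2]
    each, and [p + 1 <= 2 * p]. *)
Lemma not_concentrated_prob (a : 'M[R]_(n, p)) : balanced_design q a ->
  fine (P [set t | design A t = a /\ ~ all_concentrated a (observations Y t)])
  <= fine (P [set t | design A t = a]) * (4 / p%:R).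
Proof.
move=> [ha _ _ _].
have p0 : 0 < p%:R :> R by rewrite ltr0n (leq_trans _ p2).
pose v (i : option 'I_p) := if i is Some k then sq_dev a k else fun=> 1.
pose m i := \sum_l v i l * (a *m x) l ord0.
pose F i := [set t | design A t = a] `&` [set t | ~~ (m i / 2 - 2 * ln p%:R
  <= \sum_l v i l * (Y l t)%:R <= 3 * m i + 2 * ln p%:R)].
apply: (@le_trans _ _ (\sum_(i in predT) fine (P (F i)))).
  apply: fine_prob_le_sum.
  - exact: (measurable_design_observations P n p A Y (fun a' y =>
      a' = a /\ ~ all_concentrated a (\col_l (y l)%:R))).
  - move=> i; exact: (measurable_design_observations P n p A Y (fun a' y =>
      a' = a /\ ~~ (m i / 2 - 2 * ln p%:R
        <= \sum_l v i l * (y l)%:R <= 3 * m i + 2 * ln p%:R))).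
  move=> t [Et]; apply: contra_notP => hF i.
  apply: contra_notT hF => hi; exists i => //; split => //=.
  move: hi; rewrite /concentrated -/(v i) -/(m i).
  suff -> : \sum_l v i l * observations Y t l ord0 = \sum_l v i l * (Y l t)%:R.
    by [].
  by apply: eq_bigr => l _; rewrite mxE.
have hc i : fine (P (F i)) <=
    fine (P [set t | design A t = a]) * (2 * p%:R ^- 2).
  apply: (observation_sum_concentration P n p x A Y hY a _ (v i)) => //.
  - by move=> l; exact: design_signal_ge0.
  - exact: leq_trans p2.
  - case: i => [k|] l /=; last by rewrite ler01 lexx.
    by apply: sq_dev_le1 => //; exact: leq_trans n2.
apply: le_trans (ler_sum _ (fun i _ => hc i)) _.
rewrite sumr_const card_option card_ord -[leLHS]mulr_natl mulrCA.
rewrite ler_wpM2l ?fine_prob_ge0//.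
have p2R : 2 <= p%:R :> R by rewrite ler_nat.
rewrite -addn1 natrD.
have -> : 4 / p%:R = (4 * p%:R) * p%:R ^- 2 :> R by field; rewrite gt_eqF.
by rewrite mulrA ler_wpM2r ?invr_ge0 ?exprn_ge0 ?ltW//; lra.
Qed.

(** The bound given the design is averaged over the finitely many 0/1 matrices,
    whose events are disjoint. *)
Lemma balanced_not_concentrated_prob :
  fine (P [set t | balanced_design q (design A t)
                   /\ ~ all_concentrated (design A t) (observations Y t)])
  <= 4 / p%:R.
Proof.
pose M (b : {ffun 'I_n * 'I_p -> bool}) : 'M[R]_(n, p) :=
  \matrix_(l, k) (b (l, k))%:R.
pose D : {pred {ffun 'I_n * 'I_p -> bool}} :=
  fun b => `[< balanced_design q (M b) >].
pose E b := [set t | design A t = M b].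
have mE b : measurable (E b).
  exact: (measurable_design_observations P n p A Y (fun a' _ => a' = M b)).
apply: (@le_trans _ _ (\sum_(b in D) fine (P [set t | design A t = M b
    /\ ~ all_concentrated (M b) (observations Y t)]))).
  apply: fine_prob_le_sum.
  - exact: (measurable_design_observations P n p A Y (fun a' y =>
      balanced_design q a' /\ ~ all_concentrated a' (\col_l (y l)%:R))).
  - move=> b; exact: (measurable_design_observations P n p A Y (fun a' y =>
      a' = M b /\ ~ all_concentrated (M b) (\col_l (y l)%:R))).
  move=> t [hb hc]; have Mt : design A t = M [ffun i => A i.1 i.2 t].
    by apply/matrixP => l k; rewrite !mxE ffunE.
  exists [ffun i => A i.1 i.2 t]; last by rewrite /= -Mt.
  by rewrite unfold_in; apply/asboolP; rewrite -Mt.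
have p0 : 0 <= 4 / p%:R :> R by rewrite divr_ge0.
apply: (@le_trans _ _ (\sum_(b in D) fine (P (E b)) * (4 / p%:R))).
  apply: ler_sum => b; rewrite unfold_in => /asboolP.
  exact: not_concentrated_prob.
rewrite -mulr_suml ler_piMl//.
apply: (@le_trans _ _ (\sum_b fine (P (E b)))).
  rewrite [leRHS](bigID (mem D))/= lerDl sumr_ge0// => b _.
  exact: fine_prob_ge0.
apply: fine_prob_sum_le1 => //.
apply/trivIsetP => b b' _ _; apply: contra_neqP => /eqP/set0P[t [Eb Eb']].
have /matrixP h : M b = M b' by rewrite -Eb -Eb'.
apply/ffunP => -[l k]; have /eqP := h l k; rewrite !mxE eqr_nat.
by case: (b _); case: (b' _).
Qed.

End good_events.

Theorem proposition9 (R : realType) (c : R) (c_gt0 : 0 < c) :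
  exists kappa C c1 c2 : R,
    [/\ 0 < kappa, 0 < C, 0 < c1 & 0 < c2] /\
    forall (n p : nat) (q : R) (x : 'cV[R]_p),
      (2 <= n)%N -> (2 <= p)%N -> 0 < q < 1 ->
      kappa * ln p%:R <= n%:R * q ^+ 2 * (1 - q) ->
      (forall k, 0 <= x k ord0) ->
    forall (d : measure_display) (T : measurableType d) (P : probability T R)
      (A : 'I_n -> 'I_p -> {RV P >-> bool}) (Y : 'I_n -> {RV P >-> nat}),
      iid_bernoulli q A ->
      cond_poisson A Y x ->
      ((1 - C / p%:R)%:E <
        P [set w | forall k : 'I_p,
             (c1 * Psi n q x k <= weight c q (design A w) (observations Y w) k
                <= c2 * Psi n q x k)%R])%E.
Proof.
(* The unbalanced designs cost [6 / p] and the counts [4 / p]; a constant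
   above their sum makes the inequality strict. *)
exists 96, 11, (Num.min (1 / 8) (3 * c / 8)), (68 + 576 * c); split.
  by split; [lra | lra | rewrite lt_min; apply/andP; split; lra | lra].
move=> n p q x n2 p2 q01 signal x0 d T P A Y hA hY.
set G := [set w | _].
have mG : measurable G.
  exact: (measurable_design_observations P n p A Y (fun a y => forall k,
    Num.min (1 / 8) (3 * c / 8) * Psi n q x k
    <= weight c q a (\col_l (y l)%:R) k <= (68 + 576 * c) * Psi n q x k)).
have h1 := unbalanced_prob P n p q A Y p2 q01 signal hA.
have h2 := balanced_not_concentrated_prob P n p q x A Y n2 p2 x0 hY.
set B1 := [set t | _] in h1; set B2 := [set t | _] in h2.
have mB1 : measurable B1.
  exact: (measurable_design_observations P n p A Y
    (fun a _ => ~ balanced_design q a)).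
have mB2 : measurable B2.
  exact: (measurable_design_observations P n p A Y (fun a y =>
    balanced_design q a /\ ~ all_concentrated n p x a (\col_l (y l)%:R))).
have cover : setT `<=` G `|` (B1 `|` B2).
  move=> t _; have [hb|hb] := pselect (balanced_design q (design A t));
    last first.
    by right; left.
  have [hc|hc] := pselect
    (all_concentrated n p x (design A t) (observations Y t)); last first.
    by right; right.
  left => k; apply: weight_equivalent => //.
  - exact: leq_trans p2.
  - by move=> l; rewrite mxE.
  - exact: (hc (Some k)).
  - exact: (hc None).
have mB : measurable (B1 `|` B2) by exact: measurableU.
have := fine_probS P _ _ measurableT (measurableU _ _ mG mB) cover.
rewrite probability_setT/=.
have := fine_probU P _ _ mG mB; have := fine_probU P _ _ mB1 mB2.
rewrite -[X in (_ < X)%E]fineK ?fin_num_measure// lte_fin.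
have p0 : 0 < p%:R^-1 :> R by rewrite invr_gt0 ltr0n (leq_trans _ p2).
move: h1 h2; lra.
Qed.
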